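(* Let $\mathcal{R}>0$, $\alpha>0$, $\beta>0$ be fixed, and let $\bar\gamma_{\mathrm{D}}>0$ with $\bar\gamma_{\mathrm{R}}=\alpha\bar\gamma_{\mathrm{D}}$ and $\bar\gamma_{\mathrm{E}}=\bar\gamma_{\mathrm{R}}/\beta$. Let $h_{\mathrm{S},\mathrm{R}},h_{\mathrm{R},\mathrm{D}},h_{\mathrm{R},\mathrm{E}}$ be independent $\mathcal{CN}(0,1)$ random variables, and define $$\mathcal{R}^{1}_{\mathrm{R}\to\mathrm{D}}=\max\left\{\log_2\frac{1+\bar\gamma_{\mathrm{D}}|h_{\mathrm{R},\mathrm{D}}|^2}{1+\bar\gamma_{\mathrm{E}}|h_{\mathrm{R},\mathrm{E}}|^2},0\right\},\qquad \mathcal{R}^{1}_{\mathrm{S}\to\mathrm{R}}=\log_2\left(1+\bar\gamma_{\mathrm{R}}|h_{\mathrm{S},\mathrm{R}}|^2\right),$$ $\mathcal{R}_1=\max\{\min\{\mathcal{R}^{1}_{\mathrm{R}\to\mathrm{D}},\mathcal{R}^{1}_{\mathrm{S}\to\mathrm{R}}\},0\}$ and $\mathcal{P}_1=\Pr(\mathcal{R}_1<\mathcal{R})$. Then as $\bar\gamma_{\mathrm{D}}\to\infty$, $$\mathcal{P}_1\approx\mathcal{P}_1^{\lim}+\hat{\mathcal{M}}_1\bar\gamma_{\mathrm{D}}^{-1},$$ in the sense that $\mathcal{P}_1\to\mathcal{P}_1^{\lim}$ and $\bar\gamma_{\mathrm{D}}(\mathcal{P}_1-\mathcal{P}_1^{\lim})\to\hat{\mathcal{M}}_1$,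 where $$\mathcal{P}_1^{\lim}=1-\frac{1}{1+\frac{\alpha}{\beta}2^{\mathcal{R}}},\qquad \hat{\mathcal{M}}_1=\frac{(2^{\mathcal{R}}-1)(1+1/\alpha)}{1+\frac{\alpha}{\beta}2^{\mathcal{R}}}.$$
   Context: $\mathcal{CN}(0,1)$ denotes a circularly symmetric complex Gaussian random variable with zero mean and unit variance (Rayleigh fading). The quantities model a decode-and-forward relay system where the eavesdropper overhears only the relay; $\bar\gamma$'s are average SNRs, $\mathcal{R}_1$ the secrecy capacity and $\mathcal{P}_1$ the secrecy outage probability. *)

(* Defs.v *)
From HB Require Import structures.
From mathcomp Require Import all_boot all_order all_algebra.
From mathcomp Require Import all_classical all_reals all_analysis.
Set Implicit Arguments. Unset Strict Implicit. Unset Printing Implicit Defensive.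
Import Order.TTheory GRing.Theory Num.Theory.
Import numFieldNormedType.Exports.
Local Open Scope classical_set_scope.
Local Open Scope ring_scope.

Section relay_defs.
Context {R : realType}.

Definition log2 (x : R) : R := ln x / ln 2.

(* A complex random variable is represented by its pair (real part, imaginary part). *)
Definition sqnorm {T : Type} (h : T -> (R * R)%type) (t : T) : R :=
  (h t).1 ^+ 2 + (h t).2 ^+ 2.

Context {d : measure_display} {T : measurableType d} (P : probability T R).

(* h ~ CN(0,1): real and imaginary parts are independent N(0,1/2),
   i.e. the law of h is the product of two N(0, 1/2) laws (std. dev. sqrt(1/2)). *)
Definition is_CN01 (h : T -> (R * R)%type) : Prop :=
  measurable_fun setT h /\
  forall A B : set R, measurable A -> measurable B ->
    P (h @^-1` (A `*` B)) =
      (normal_prob 0 (Num.sqrt (2^-1)) A * normal_prob 0 (Num.sqrt (2^-1)) B)%E.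

Definition indep3 (h1 h2 h3 : T -> (R * R)%type) : Prop :=
  forall A1 A2 A3 : set (R * R)%type,
    measurable A1 -> measurable A2 -> measurable A3 ->
    P (h1 @^-1` A1 `&` h2 @^-1` A2 `&` h3 @^-1` A3) =
      (P (h1 @^-1` A1) * P (h2 @^-1` A2) * P (h3 @^-1` A3))%E.

Definition rate_RD (gD gE : R) (hRD hRE : T -> (R * R)%type) (t : T) : R :=
  Num.max (log2 ((1 + gD * sqnorm hRD t) / (1 + gE * sqnorm hRE t))) 0.

Definition rate_SR (gR : R) (hSR : T -> (R * R)%type) (t : T) : R :=
  log2 (1 + gR * sqnorm hSR t).

Definition secrecy_cap1 (alpha beta gD : R) (hSR hRD hRE : T -> (R * R)%type)
  (t : T) : R :=
  let gR := alpha * gD in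
  let gE := gR / beta in
  Num.max (Num.min (rate_RD gD gE hRD hRE t) (rate_SR gR hSR t)) 0.

Definition outage1 (Rth alpha beta gD : R) (hSR hRD hRE : T -> (R * R)%type) : R :=
  fine (P [set t | secrecy_cap1 alpha beta gD hSR hRD hRE t < Rth]).

End relay_defs.

Definition P1_lim {R : realType} (Rth alpha beta : R) : R :=
  1 - (1 + alpha / beta * (2 `^ Rth))^-1.

Definition M1_hat {R : realType} (Rth alpha beta : R) : R :=
  ((2 `^ Rth - 1) * (1 + alpha^-1)) / (1 + alpha / beta * (2 `^ Rth)).

(* Main.v *)
Require Import Defs.
From HB Require Import structures.
From mathcomp Require Import all_boot all_order all_algebra.
From mathcomp Require Import all_classical all_reals all_analysis.
From mathcomp Require Import measurable_realfun ring.
Import Order.TTheory GRing.Theory Num.Theory.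
Import numFieldNormedType.Exports.
Local Open Scope classical_set_scope.
Local Open Scope ring_scope.

(* With c = 2^Rth and k = c alpha / beta, there is no outage iff
   |h_SR|^2 >= (c - 1) / (alpha gD) and |h_RD|^2 >= (c - 1) / gD + k |h_RE|^2.
   For h ~ CN(0,1) one has P(|h|^2 >= s) = exp(-s) and E exp(-k |h|^2) =
   1 / (1 + k), so by independence
     P_1 = 1 - exp(- (c - 1) (1 + 1 / alpha) / gD) / (1 + k)
   exactly, and both limits follow from g (1 - exp(- m / g)) --> m. The tail of
   |h|^2 is computed without polar coordinates: substituting y = |x| t in
   the integral of exp(- x^2 - y^2) and exchanging the integrals leaves an
   elementary integral in x and then the integral of 1 / (1 + t^2). *)

(** * Gaussian integrals on the line and the plane, and the law of CN(0,1) *)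

Section gaussian_integrals.
Context {R : realType}.
Notation mu := (@lebesgue_measure R).
Implicit Types (f : R -> \bar R) (a w s u : R).

(** Lebesgue measure is determined by its values on intervals []p, q]], and [a] times its image
    under multiplication by [a] gives such an interval the mass [a * (q / a - p / a) = q - p]. *)
Lemma ge0_integral_lebesgue_scale f a : 0 < a ->
  measurable_fun [set: R] f -> (forall x, 0 <= f x)%E ->
  (\int[mu]_x f x = a%:E * \int[mu]_x f (a * x)%R)%E.
Proof.
move=> a0 mf f0.
pose mR := measurableTypeR R.
have ma : measurable_fun setT ( *%R a : mR -> mR) by exact: measurable_funM.
unshelve epose (nu := pushforward mu ( *%R a : mR -> mR) :
  {measure set mR -> \bar R}); first exact: ma.
pose k : {nonneg R} := NngNum (ltW a0).
transitivity (\int[mscale k nu]_x f x)%E.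
  apply: eq_measure_integral => //= A mA _.
  apply: lebesgue_measure_unique => //= _ [[p q]] _ <-.
  rewrite /mscale /= /pushforward.
  rewrite [X in (_ * mu X)%E](_ : _ = `]p / a, q / a]%classic); last first.
    apply/seteqP; split => x /=; rewrite !in_itv/=;
      by rewrite ltr_pdivrMr// ler_pdivlMr// (mulrC a).
  rewrite !lebesgue_measure_itv/= !lte_fin ltr_pM2r ?invr_gt0//.
  case: ifPn => _; last by rewrite mule0.
  by rewrite -EFinB -EFinM -mulrBl mulrC divfK ?gt_eqF.
rewrite ge0_integral_mscale//=.
by rewrite ge0_integral_pushforward.
Qed.

Lemma ge0_even_integralT f :
  measurable_fun [set: R] f -> (forall x, 0 <= f x)%E ->
  (forall x, f (- x) = f x) ->
  (\int[mu]_x f x = 2%:E * \int[mu]_(x in `[0%R, +oo[) f x)%E.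
Proof.
move=> mf f0 fN.
rewrite -(setUv `[0, +oo[%classic) ge0_integral_setU//=; last 3 first.
  exact: measurableC.
  by rewrite setUv.
  exact/disj_setPCl.
rewrite mule_natl mule2n; congr +%E.
rewrite setCitvr/= ge0_integration_by_substitution0//.
rewrite integral_itv_bndo_bndc//; last exact: measurable_funTS.
by apply: eq_integral => x _; rewrite fN.
Qed.

Lemma integral_oneDsqrV : (\int[mu]_x (oneDsqr x)^-1%:E = pi%:E)%E.
Proof.
rewrite ge0_even_integralT//.
- by rewrite integral0y_oneDsqr -EFinM mulrCA divff ?mulr1.
- apply/measurable_EFinP; apply: continuous_measurable_fun.
  exact: continuous_oneDsqrV.
- by move=> x; rewrite /oneDsqr sqrrN.
Qed.

Lemma integral_expR_sqr a : 0 < a ->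
  (\int[mu]_x (expR (- (a * x ^+ 2)))%:E = (Num.sqrt (pi / a))%:E)%E.
Proof.
move=> a0; have sa0 : 0 < Num.sqrt a by rewrite sqrtr_gt0.
have := @integralT_gauss R.
rewrite (ge0_integral_lebesgue_scale _ (Num.sqrt a))//; last 2 first.
- by apply/measurable_EFinP; exact: measurable_gauss_fun.
- by move=> x; rewrite lee_fin gauss_fun_ge0.
under eq_integral do rewrite /gauss_fun exprMn sqr_sqrtr ?ltW//.
move=> h; rewrite sqrtrM ?pi_ge0// sqrtrV ?(ltW a0)// EFinM -h muleAC -EFinM.
by rewrite divff ?mul1e ?gt_eqF.
Qed.

(* The unnormalised Gaussian density cut off to |z|^2 >= s, as a function of
   u = |z|^2. *)
Definition exp_tail s u : R := if s <= u then expR (- u) else 0.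

Lemma exp_tail_ge0 s u : 0 <= exp_tail s u.
Proof. by rewrite /exp_tail; case: ifP. Qed.

Lemma measurable_exp_tail s : measurable_fun setT (exp_tail s).
Proof.
apply: measurable_fun_ifT => //=; first exact: measurable_fun_ler.
exact: measurableT_comp.
Qed.

(** The factor [|x|] makes the integrand elementary: on the positive half-line,
    [x * expR (- (w * x ^+ 2))] has an explicit primitive. This is the inner integral left by the
    substitution [y = |x| t], with [w = 1 + t ^+ 2]. *)
Lemma integral_exp_tail_sqr s w : 0 <= s -> 0 < w ->
  (\int[mu]_x (`|x| * exp_tail s (w * x ^+ 2))%:E = (expR (- s) / w)%:E)%E.
Proof.
move=> s0 w0.
have mg : measurable_fun [set: R] (fun x : R => `|x| * exp_tail s (w * x ^+ 2)).
  apply: measurable_funM => //.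
  by apply: measurableT_comp (measurable_exp_tail s) _; exact: measurable_funM.
rewrite ge0_even_integralT//; first last.
- by move=> x; rewrite normrN sqrrN.
- by move=> x; rewrite lee_fin mulr_ge0 ?exp_tail_ge0.
- exact/measurable_EFinP.
(* The cutoff [s <= w * x ^+ 2] amounts to [r <= x] for nonnegative [x]. *)
pose r := Num.sqrt (s / w).
have r0 : 0 <= r by exact: sqrtr_ge0.
have sr : w * r ^+ 2 = s.
  by rewrite sqr_sqrtr; [rewrite mulrC divfK ?gt_eqF|rewrite divr_ge0// ltW].
have -> : (\int[mu]_(x in `[0%R, +oo[) (`|x| * exp_tail s (w * x ^+ 2))%:E =
   \int[mu]_(x in `[r, +oo[) (x * expR (- (w * x ^+ 2)))%:E)%E.
  rewrite [LHS]integral_mkcond [RHS]integral_mkcond.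
  apply: eq_integral => x _; rewrite !patchE !mem_setE !in_itv/= !andbT.
  have [rx|xr] := leP r x.
    rewrite (le_trans r0 rx) ger0_norm ?(le_trans r0 rx)// /exp_tail.
    rewrite -[s in s <= _]sr ler_pM2l// ler_pXn2r// ?nnegrE ?(le_trans r0 rx)//.
    by rewrite rx.
  case: ifPn => // x0; rewrite /exp_tail -[s in s <= _]sr ler_pM2l//.
  by rewrite ler_pXn2r// ?nnegrE// leNgt xr/= mulr0.
pose F (x : R) := - (expR (- (w * x ^+ 2)) / (w *+ 2)).
have dF x : is_derive x (1 : R) F (x * expR (- (w * x ^+ 2))).
  have dsq : is_derive x (1 : R) (fun x : R => - (w * x ^+ 2))
      (- (w * (x *+ 2))).
    by apply: is_derive_eq; rewrite /GRing.scale/= mulr1 mulr2n.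
  apply: is_derive_eq; rewrite scaler0 add0r /GRing.scale/=.
  by field; rewrite gt_eqF.
have cF : continuous F.
  move=> x; apply/differentiable_continuous/derivable1_diffP.
  by have [] := dF x.
rewrite (@ge0_continuous_FTC2y _ _ F _ 0).
- by rewrite /F sr sub0e -EFinN -EFinM opprK; congr EFin; field; rewrite gt_eqF.
- by move=> x rx; rewrite mulr_ge0 ?expR_ge0// (le_trans r0).
- apply: continuous_subspaceT => x; apply: cvgM; first exact: cvg_id.
  apply: (cvg_comp (fun x => - (w * x ^+ 2)) expR); last exact: continuous_expR.
  by apply: cvgN; apply: cvgMr; exact: exprn_continuous.
- rewrite -oppr0; apply: cvgN; rewrite -(mul0r (w *+ 2)^-1); apply: cvgMl.
  apply: (cvg_comp (fun x => w * x ^+ 2) (fun x => expR (- x)));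
    last exact: cvgr_expR.
  by apply: gt0_cvgMry => //; exact: cvgr_expr2.
- by move=> x _; have [] := dF x.
- exact/cvg_at_right_filter/cF.
- by move=> x _; rewrite derive1E; apply: derive_val.
Qed.

Lemma measurable_sqrD :
  measurable_fun [set: R * R] (fun z : R * R => z.1 ^+ 2 + z.2 ^+ 2).
Proof. by apply: measurable_funD; exact: measurable_funX. Qed.


Lemma integral_exp_tail_sqrD s : 0 <= s ->
  (\int[mu]_x \int[mu]_y (exp_tail s (x ^+ 2 + y ^+ 2))%:E =
   (pi * expR (- s))%:E)%E.
Proof.
move=> s0; pose mR := measurableTypeR R.
pose H (z : mR * mR) := (exp_tail s (z.1 ^+ 2 + z.2 ^+ 2))%:E.
(* The integrand after [y = |x| t]: the Jacobian is [|x|], and [x ^+ 2 + y ^+ 2] becomes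
   [(1 + t ^+ 2) * x ^+ 2]. *)
pose K (z : mR * mR) := (`|z.1| * exp_tail s (oneDsqr z.2 * z.1 ^+ 2))%:E.
have mH : measurable_fun [set: mR * mR] H.
  apply/measurable_EFinP; apply: measurableT_comp (measurable_exp_tail s) _.
  exact: measurable_sqrD.
have mK : measurable_fun [set: mR * mR] K.
  apply/measurable_EFinP; apply: measurable_funM; first exact: measurableT_comp.
  apply: measurableT_comp; first exact: measurable_exp_tail.
  apply: measurable_funM; last exact: measurable_funX.
  by apply: measurable_funD => //; exact: measurable_funX.
have H0 z : (0 <= H z)%E by rewrite lee_fin exp_tail_ge0.
have K0 z : (0 <= K z)%E by rewrite lee_fin mulr_ge0 ?exp_tail_ge0.
transitivity (\int[mu]_x \int[mu]_t K (x, t))%E.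
  apply: ae_eq_integral => //.
  - exact: (measurable_fun_fubini_tonelli_F H mH H0).
  - exact: (measurable_fun_fubini_tonelli_F K mK K0).
  (* The substitution degenerates at [x = 0], so the two inner integrals are compared only off this
     null set. *)
  exists [set 0]; split => //; first exact: lebesgue_measure_set1.
  move=> x /= Hx; apply: contrapT => /eqP x0; apply: Hx => _.
  have nx0 : 0 < `|x| by rewrite normr_gt0.
  rewrite (ge0_integral_lebesgue_scale _ `|x|)//; last 2 first.
  - apply/measurable_EFinP; apply: measurableT_comp (measurable_exp_tail s) _.
    by apply: measurable_funD => //; exact: measurable_funX.
  - by move=> y; rewrite lee_fin exp_tail_ge0.
  rewrite -ge0_integralZl//; last 2 first.
  - apply/measurable_EFinP; apply: measurableT_comp (measurable_exp_tail s) _.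
    apply: measurable_funD => //.
    by apply: measurable_funX; exact: measurable_funM.
  - by move=> y _; rewrite lee_fin exp_tail_ge0.
  apply: eq_integral => t _; rewrite /K -EFinM/=; congr (_ * exp_tail _ _)%:E.
  by rewrite exprMn real_normK ?num_real// /oneDsqr; ring.
rewrite (fubini_tonelli K mK K0)//.
under eq_integral => t _.
  rewrite (_ : (\int[mu]_x K (x, t) = (expR (- s) * (oneDsqr t)^-1)%:E)%E);
    last first.
    apply: (integral_exp_tail_sqr s (oneDsqr t) s0).
    by rewrite (lt_le_trans ltr01).
  rewrite EFinM; over.
rewrite ge0_integralZl//; first by rewrite integral_oneDsqrV -EFinM mulrC.
apply/measurable_EFinP; apply: continuous_measurable_fun.
exact: continuous_oneDsqrV.
Qed.

(** The Radon-Nikodym derivative of the normal law and [normal_pdf] have the same integral over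
    every measurable set, hence agree almost everywhere; the change of variables for the former then
    transfers to the latter. *)
Lemma ge0_integral_normal_prob m s f : measurable_fun [set: R] f ->
  (forall x, 0 <= f x)%E ->
  (\int[normal_prob m s]_x f x = \int[mu]_x (f x * (normal_pdf m s x)%:E))%E.
Proof.
move=> mf f0.
have dom := @normal_prob_dominates R m s.
rewrite -(Radon_Nikodym_SigmaFinite.change_of_variables dom)//=.
apply: ae_eq_integral => //.
- apply: emeasurable_funM => //.
  exact: measurable_int (Radon_Nikodym_SigmaFinite.f_integrable dom).
- apply: emeasurable_funM => //; apply/measurable_EFinP.
  exact: measurable_normal_pdf.
- apply: ae_eqe_mul2l; apply: integral_ae_eq => //=.
  + exact: Radon_Nikodym_SigmaFinite.f_integrable.
  + by apply/measurable_EFinP; exact: measurable_normal_pdf.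
  + by move=> E _ mE; rewrite -Radon_Nikodym_SigmaFinite.f_integral.
Qed.

Lemma normal_pdf_half (x : R) :
  normal_pdf 0 (Num.sqrt 2^-1) x = (Num.sqrt pi)^-1 * expR (- x ^+ 2).
Proof.
rewrite normal_pdfE ?gt_eqF ?sqrtr_gt0 ?invr_gt0// /normal_peak /normal_fun.
rewrite sqr_sqrtr ?invr_ge0// subr0 -mulrnAl -mulr_natr mulVf// mul1r divr1.
by [].
Qed.

Lemma measurable_expR_sqr a :
  measurable_fun [set: R] (fun x : R => (expR (- (a * x ^+ 2)))%:E).
Proof.
apply/measurable_EFinP; apply: measurableT_comp => //.
by apply: measurableT_comp => //; exact: measurable_funM.
Qed.

(** Variance 1/2 gives the density [expR (- x ^+ 2) / Num.sqrt pi], so the exponents merge into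
    [- ((1 + k) * x ^+ 2)]. *)
Lemma integral_normal_half_expR (k : R) : 0 <= k ->
  (\int[normal_prob 0 (Num.sqrt 2^-1)]_x (expR (- (k * x ^+ 2)))%:E =
   (Num.sqrt (1 + k))^-1%:E)%E.
Proof.
move=> k0; have k1 : 0 < 1 + k by rewrite ltr_wpDr.
rewrite ge0_integral_normal_prob//; last exact: measurable_expR_sqr.
under eq_integral => x _.
  rewrite normal_pdf_half -EFinM mulrCA -expRD -opprD.
  rewrite -{2}[x ^+ 2]mul1r -mulrDl addrC EFinM.
  over.
rewrite ge0_integralZl//; last exact: measurable_expR_sqr.
rewrite integral_expR_sqr// -EFinM sqrtrM ?pi_ge0// sqrtrV ?ltW//.
by rewrite mulKf// gt_eqF// sqrtr_gt0 pi_gt0.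
Qed.

(** The law that [is_CN01] prescribes on rectangles, as an actual measure on the plane. *)
Definition cn01 : probability (measurableTypeR R * measurableTypeR R)%type R :=
  (normal_prob 0 (Num.sqrt 2^-1) \x normal_prob 0 (Num.sqrt 2^-1))%E.

Lemma measurable_sqrD_ge s :
  measurable [set z : R * R | s <= z.1 ^+ 2 + z.2 ^+ 2].
Proof.
rewrite -[X in measurable X]setTI.
by apply: measurable_fun_le => //; exact: measurable_sqrD.
Qed.

(** The integrand factors over the two coordinates, each contributing [(Num.sqrt (1 + k))^-1]. *)
Lemma integral_cn01_expR (k : R) : 0 <= k ->
  (\int[cn01]_z (expR (- (k * (z.1 ^+ 2 + z.2 ^+ 2))))%:E = (1 + k)^-1%:E)%E.
Proof.
move=> k0; have k1 : 0 < 1 + k by rewrite ltr_wpDr.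
rewrite fubini_tonelli1//=; last first.
  do 3 apply: measurableT_comp => //.
  by apply: measurable_funM => //; exact: measurable_sqrD.
rewrite /fubini_F.
under eq_integral => x _.
  under eq_integral => y _.
    rewrite /= mulrDr opprD expRD EFinM; over.
  rewrite ge0_integralZl//; last exact: measurable_expR_sqr.
  rewrite integral_normal_half_expR//; over.
rewrite ge0_integralZr//; last exact: measurable_expR_sqr.
by rewrite integral_normal_half_expR// -EFinM -invfM -expr2 sqr_sqrtr ?ltW//.
Qed.

(** The product density is [expR (- |z|^2) / pi], so the mass is [pi^-1] times the plane integral of
    [exp_tail], and the factor [pi] cancels. *)
Lemma cn01_sqnorm_ge s : 0 <= s ->
  cn01 [set z : R * R | (s <= z.1 ^+ 2 + z.2 ^+ 2)%R] = (expR (- s))%:E.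
Proof.
move=> s0.
have mA := measurable_sqrD_ge s.
set A := [set z : R * R | _] in mA *.
rewrite /cn01 /= /product_measure1 /= ge0_integral_normal_prob//; last first.
  exact: measurable_fun_xsection.
transitivity (\int[mu]_x (pi^-1%:E *
    \int[mu]_y (exp_tail s (x ^+ 2 + y ^+ 2))%:E))%E.
  apply: eq_integral => x _.
  have pi_inv : (pi : R)^-1 = (Num.sqrt pi)^-1 * (Num.sqrt pi)^-1.
    by rewrite -invfM -expr2 sqr_sqrtr ?pi_ge0.
  rewrite /= /normal_prob integral_mkcond/= muleC.
  rewrite -ge0_integralZl//; last 3 first.
  - apply/(measurable_restrictT _ _).1; first exact: measurable_xsection.
    by apply/measurable_funTS/measurable_EFinP; exact: measurable_normal_pdf.
  - move=> y _; rewrite patchE; case: ifP => // _.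
    by rewrite lee_fin normal_pdf_ge0.
  - by rewrite lee_fin normal_pdf_ge0.
  rewrite -ge0_integralZl//; last 3 first.
  - apply/measurable_EFinP; apply: measurableT_comp (measurable_exp_tail s) _.
    by apply: measurable_funD => //; exact: measurable_funX.
  - by move=> y _; rewrite lee_fin exp_tail_ge0.
  - by rewrite lee_fin invr_ge0 pi_ge0.
  apply: eq_integral => y _; rewrite patchE /exp_tail.
  have -> : (y \in xsection A x) = (s <= x ^+ 2 + y ^+ 2).
    by rewrite mem_xsection; apply/idP/idP; rewrite inE.
  case: ifPn => _; last by rewrite !mule0.
  rewrite -!EFinM !normal_pdf_half; congr EFin.
  by rewrite mulrACA -expRD -opprD -pi_inv.
rewrite ge0_integralZl//; last 3 first.
- pose mR := measurableTypeR R.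
  pose H (z : mR * mR) := (exp_tail s (z.1 ^+ 2 + z.2 ^+ 2))%:E.
  have mH : measurable_fun [set: mR * mR] H.
    apply/measurable_EFinP; apply: measurableT_comp (measurable_exp_tail s) _.
    exact: measurable_sqrD.
  have H0 z : (0 <= H z)%E by rewrite lee_fin exp_tail_ge0.
  exact: (measurable_fun_fubini_tonelli_F H mH H0).
- by move=> x _; apply: integral_ge0 => y _; rewrite lee_fin exp_tail_ge0.
- by rewrite lee_fin invr_ge0 pi_ge0.
by rewrite integral_exp_tail_sqrD// -EFinM mulKf ?gt_eqF ?pi_gt0.
Qed.

End gaussian_integrals.

(** * Laws of the fading coefficients and of an independent pair *)

Section fading.
Context {R : realType} {d : measure_display} {T : measurableType d}.
Context (P : probability T R).
Implicit Types h : T -> R * R.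

(** A measure on the plane that agrees with a product of sigma-finite measures on rectangles is that
    product. *)
Lemma is_CN01_law h (A : set (R * R)) : is_CN01 P h -> measurable A ->
  P (h @^-1` A) = cn01 A.
Proof.
move=> [mh hE] mA; pose mR := measurableTypeR R.
pose N : {sigma_finite_measure set mR -> \bar R} :=
  normal_prob 0 (Num.sqrt 2^-1).
unshelve epose (nu := pushforward P (h : T -> mR * mR) :
  {measure set (mR * mR)%type -> \bar R}); first exact: mh.
have nuE (B C : set mR) : measurable B -> measurable C ->
    nu (B `*` C) = (N B * N C)%E.
  exact: hE.
exact/esym/(@product_measure_unique _ _ _ _ R N N nu nuE A mA).
Qed.

Lemma is_CN01_sqnorm_ge h (s : R) : is_CN01 P h -> 0 <= s ->
  P [set t | s <= sqnorm h t] = (expR (- s))%:E.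
Proof.
move=> hh s0; rewrite -(cn01_sqnorm_ge _ s0) -(is_CN01_law h)//.
exact: measurable_sqrD_ge.
Qed.

Lemma indep3_pair_law h1 h2 h3 (A : set (R * R)) (E : set ((R * R) * (R * R))) :
  is_CN01 P h1 -> is_CN01 P h2 -> is_CN01 P h3 -> indep3 P h1 h2 h3 ->
  measurable A -> measurable E -> (0 < P (h1 @^-1` A))%E ->
  P (h1 @^-1` A `&` [set t | E (h3 t, h2 t)]) =
    (P (h1 @^-1` A) * (cn01 \x cn01) E)%E.
Proof.
move=> c1 c2 c3 ind mA mE A0.
have [[mh1 _] [mh2 _] [mh3 _]] := And3 c1 c2 c3.
have mD : measurable (h1 @^-1` A).
  by rewrite -[X in measurable X]setTI; exact: mh1.
set D := h1 @^-1` A in mD A0 *.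
have [p PDE] : exists p, P D = p%:E.
  by exists (fine (P D)); rewrite fineK//; exact: fin_num_measure.
have p0 : 0 < p by rewrite -lte_fin -PDE.
have mh32 : measurable_fun setT (fun t => (h3 t, h2 t)).
  exact: measurable_fun_pair.
pose mR := measurableTypeR R.
unshelve epose (nu := pushforward (mrestr P mD)
    ((fun t => (h3 t, h2 t)) : T -> (mR * mR * (mR * mR))%type) :
  {measure set (mR * mR * (mR * mR))%type -> \bar R}); first exact: mh32.
have ip0 : 0 <= p^-1 by rewrite invr_ge0 ltW.
pose nu' : {measure set (mR * mR * (mR * mR))%type -> \bar R} :=
  mscale (NngNum ip0) nu.
have nuE (B B' : set (mR * mR)%type) : measurable B -> measurable B' ->
    nu' (B `*` B') = (cn01 B * cn01 B')%E.
  move=> mB mB'.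
  rewrite -[cn01 B](is_CN01_law h3 B c3 mB).
  rewrite -[cn01 B'](is_CN01_law h2 B' c2 mB').
  rewrite /nu' /nu /= /mscale/= /pushforward /mrestr.
  rewrite (_ : _ `&` D = D `&` h2 @^-1` B' `&` h3 @^-1` B); last first.
    by apply/seteqP; split => t /=; tauto.
  rewrite (ind A B' B)// -/D PDE !muleA -EFinM mulVf ?gt_eqF// mul1e.
  by rewrite muleC.
have -> := @product_measure_unique _ _ _ _ R cn01 cn01 nu' nuE E mE.
rewrite /nu' /nu /= /mscale/= /pushforward /mrestr.
rewrite muleA PDE -EFinM divff ?gt_eqF// mul1e.
by rewrite setIC.
Qed.

End fading.

(** * The exact outage probability *)

Section outage.
Context {R : realType}.

Lemma measurable_threshold (a k : R) : measurable
  [set z : (R * R) * (R * R) |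
    a + k * (z.1.1 ^+ 2 + z.1.2 ^+ 2) <= z.2.1 ^+ 2 + z.2.2 ^+ 2].
Proof.
rewrite -[X in measurable X]setTI; apply: measurable_fun_le => //.
  apply: measurable_funD => //; apply: measurable_funM => //.
  exact: (measurableT_comp measurable_sqrD measurable_fst).
exact: (measurableT_comp measurable_sqrD measurable_snd).
Qed.

(** For fixed [z.1] the section is a tail event of mass [expR (- a) * expR (- (k * |z.1|^2))];
    integrating over [z.1] gives the factor [1 / (1 + k)]. *)
Lemma cn01_threshold (a k : R) : 0 <= a -> 0 <= k ->
  (cn01 \x cn01)%E
    [set z : (R * R) * (R * R) |
      a + k * (z.1.1 ^+ 2 + z.1.2 ^+ 2) <= z.2.1 ^+ 2 + z.2.2 ^+ 2] =
  (expR (- a) / (1 + k))%:E.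
Proof.
move=> a0 k0; rewrite /product_measure1/=.
transitivity (\int[cn01]_z ((expR (- a))%:E *
    (expR (- (k * (z.1 ^+ 2 + z.2 ^+ 2))))%:E))%E.
  apply: eq_integral => z _.
  rewrite -EFinM -expRD -opprD -cn01_sqnorm_ge; last first.
    by rewrite addr_ge0// mulr_ge0// addr_ge0// sqr_ge0.
  by apply: congr1; apply/seteqP; split => y; rewrite /xsection/= inE.
rewrite ge0_integralZl//; first by rewrite integral_cn01_expR// -EFinM.
do 3 apply: measurableT_comp => //.
by apply: measurable_funM => //; exact: measurable_sqrD.
Qed.

Lemma le_log2 (r x : R) : 0 < x -> (r <= log2 x) = (2 `^ r <= x).
Proof.
move=> x0; rewrite /log2 ler_pdivlMr ?ln_gt0 ?ltr1n//.
by rewrite /powR pnatr_eq0/= -[in RHS](lnK x0) ler_expR.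
Qed.

Lemma powR2_gt1 (r : R) : 0 < r -> 1 < 2 `^ r.
Proof.
by move=> r0; rewrite /powR pnatr_eq0/= expR_gt1 mulr_gt0// ln_gt0 ?ltr1n.
Qed.

Context {d : measure_display} {T : measurableType d} (P : probability T R).
Variables (hSR hRD hRE : T -> R * R) (Rth alpha beta : R).
Hypotheses (Rth0 : 0 < Rth) (alpha0 : 0 < alpha) (beta0 : 0 < beta).
Local Notation c := (2 `^ Rth).

Lemma sqnorm_ge0 (h : T -> R * R) t : 0 <= sqnorm h t.
Proof. by rewrite addr_ge0 ?sqr_ge0. Qed.

(** Both rate conditions become linear in the squared norms once the logarithms and denominators are
    cleared. The eavesdropper's SNR is [alpha / beta] times [gD], so the slope [alpha / beta * c]
    does not depend on [gD]; this is why the outage keeps a nonzero limit. *)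
Lemma secrecy_cap1_geE gD t : 0 < gD ->
  (Rth <= secrecy_cap1 alpha beta gD hSR hRD hRE t) =
  ((c - 1) / (alpha * gD) <= sqnorm hSR t) &&
  ((c - 1) / gD + alpha / beta * c * sqnorm hRE t <= sqnorm hRD t).
Proof.
move=> g0; have ag0 : 0 < alpha * gD by rewrite mulr_gt0.
have E0 : 0 < 1 + alpha * gD / beta * sqnorm hRE t.
  by rewrite ltr_wpDr// !mulr_ge0 ?sqnorm_ge0 ?invr_ge0 ?ltW.
have D0 : 0 < 1 + gD * sqnorm hRD t.
  by rewrite ltr_wpDr// mulr_ge0 ?sqnorm_ge0 ?ltW.
have S0 : 0 < 1 + alpha * gD * sqnorm hSR t.
  by rewrite ltr_wpDr// mulr_ge0 ?sqnorm_ge0 ?ltW.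
rewrite /secrecy_cap1 /rate_RD /rate_SR le_max le_min le_max.
(* Since [Rth] is positive, the alternatives [Rth <= 0] coming from the maxima with 0 disappear. *)
rewrite !(leNgt Rth 0) Rth0 !orbF.
rewrite !le_log2// ?divr_gt0// andbC; congr (_ && _).
  by rewrite ler_pdivrMr// lerBlDl (mulrC (sqnorm _ _)).
rewrite ler_pdivlMr// -(ler_pM2l g0 _ (sqnorm hRD t)) -lerBlDl.
congr (_ <= _); field.
by rewrite !gt_eqF.
Qed.

(** Outage is the complement of [G], where the source-relay tail is independent of the pair
    [(hRE, hRD)]. The exponents [b] and [a] of the two factors add up to
    [(c - 1) * (1 + alpha^-1) / gD]. *)
Lemma outage1E gD : is_CN01 P hSR -> is_CN01 P hRD -> is_CN01 P hRE ->
  indep3 P hSR hRD hRE -> 0 < gD ->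
  outage1 P Rth alpha beta gD hSR hRD hRE =
  1 - expR (- ((c - 1) * (1 + alpha^-1) / gD)) / (1 + alpha / beta * c).
Proof.
move=> cSR cRD cRE ind g0.
have c1 : 0 <= c - 1 by rewrite subr_ge0 ltW// powR2_gt1.
have ag0 : 0 < alpha * gD by rewrite mulr_gt0.
pose b := (c - 1) / (alpha * gD); have b0 : 0 <= b by rewrite divr_ge0// ltW.
pose a := (c - 1) / gD; have a0 : 0 <= a by rewrite divr_ge0// ltW.
pose k := alpha / beta * c.
have k0 : 0 <= k by rewrite mulr_ge0 ?powR_ge0// divr_ge0// ltW.
pose E := [set z : (R * R) * (R * R) |
    a + k * (z.1.1 ^+ 2 + z.1.2 ^+ 2) <= z.2.1 ^+ 2 + z.2.2 ^+ 2].
pose A := [set z : R * R | b <= z.1 ^+ 2 + z.2 ^+ 2].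
pose G := hSR @^-1` A `&` [set t | E (hRE t, hRD t)].
have mA : measurable A by exact: measurable_sqrD_ge.
have mE : measurable E by exact: measurable_threshold.
have PA : P (hSR @^-1` A) = (expR (- b))%:E by exact: is_CN01_sqnorm_ge.
have mG : measurable G.
  have [[mSR _] [mRD _] [mRE _]] := And3 cSR cRD cRE.
  apply: measurableI; first by rewrite -[X in measurable X]setTI; exact: mSR.
  rewrite -[X in measurable X]setTI.
  exact: (measurable_fun_pair mRE mRD).
have PG : P G = (expR (- ((c - 1) * (1 + alpha^-1) / gD)) / (1 + k))%:E.
  rewrite (indep3_pair_law _ hSR hRD hRE)// ?PA ?lte_fin ?expR_gt0//.
  rewrite cn01_threshold// -EFinM mulrA -expRD -opprD.
  congr (expR (- _) / _)%:E.
  by rewrite /a /b; field; rewrite !gt_eqF.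
rewrite /outage1 (_ : [set t | _] = ~` G); last first.
  apply/seteqP; split => t /=.
    rewrite ltNge secrecy_cap1_geE// => /negP H [? ?]; apply: H.
    by apply/andP.
  move=> H; rewrite ltNge secrecy_cap1_geE//.
  by apply/negP => /andP[bX aY]; apply: H.
by rewrite probability_setC// PG.
Qed.

End outage.

(** * Asymptotics as the average SNR tends to infinity *)

Lemma cvg_invr_pinfty {R : realType} : g^-1 @[g --> +oo] --> (0 : R).
Proof.
apply/gtr0_cvgV0; last exact: cvg_id.
exact: nbhs_pinfty_gt.
Qed.

(** With [u = m / g], the bound [1 + x <= expR x] at [x = - u] and at [x = u] gives [u * (1 - u) <=
    u * expR (- u) <= 1 - expR (- u) <= u]. Multiplying by [g] squeezes the expression between
    [m - m ^+ 2 / g] and [m]. *)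
Lemma cvg_mul_1BexpR {R : realType} (m : R) : 0 <= m ->
  g * (1 - expR (- (m / g))) @[g --> +oo] --> m.
Proof.
move=> m0.
apply: (@squeeze_cvgr _ _ _ _ (fun g => m - m ^+ 2 * g^-1) (cst m)).
- near=> g.
  have g0 : 0 < g by near: g; exact: nbhs_pinfty_gt.
  set u := m / g.
  have u0 : 0 <= u by rewrite divr_ge0// ltW.
  have mE : m = g * u by rewrite mulrC divfK ?gt_eqF.
  have lo : 1 - u <= expR (- u) by exact: expR_ge1Dx.
  have up : u * expR (- u) <= 1 - expR (- u).
    rewrite lerBrDr -[X in _ + X]mul1r -mulrDl addrC.
    by rewrite -ler_pdivlMr ?expR_gt0// mul1r -expRN opprK expR_ge1Dx.
  apply/andP; split.
    have -> : m - m ^+ 2 * g^-1 = g * (u * (1 - u)).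
      by rewrite /u; field; rewrite gt_eqF.
    rewrite ler_pM2l// (le_trans _ up)// ler_wpM2l//.
  by rewrite /= [leRHS]mE ler_pM2l// lerBlDl -lerBlDr.
- rewrite -[X in _ --> X]subr0 -(mulr0 (m ^+ 2)).
  by apply: cvgB; [exact: cvg_cst|apply: cvgMr; exact: cvg_invr_pinfty].
- exact: cvg_cst.
Unshelve. all: by end_near. Qed.

Theorem theorem3 (R : realType) (d : measure_display) (T : measurableType d)
  (P : probability T R) (hSR hRD hRE : T -> (R * R)%type)
  (Rth alpha beta : R) :
  0 < Rth -> 0 < alpha -> 0 < beta ->
  is_CN01 P hSR -> is_CN01 P hRD -> is_CN01 P hRE ->
  indep3 P hSR hRD hRE ->
  (outage1 P Rth alpha beta gD hSR hRD hRE @[gD --> +oo] --> P1_lim Rth alpha beta)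
  /\
  (gD * (outage1 P Rth alpha beta gD hSR hRD hRE - P1_lim Rth alpha beta)
     @[gD --> +oo] --> M1_hat Rth alpha beta).
Proof.
move=> Rth0 alpha0 beta0 cSR cRD cRE ind.
set f := fun gD => outage1 P Rth alpha beta gD hSR hRD hRE.
set l := P1_lim Rth alpha beta; set M := M1_hat Rth alpha beta.
(* The first-order limit comes first. As [l = 1 - q], the exact formula gives
   [f g - l = (1 - expR (- (m / g))) * q]. *)
have fM : gD * (f gD - l) @[gD --> +oo] --> M.
  pose m := (2 `^ Rth - 1) * (1 + alpha^-1).
  have m0 : 0 <= m.
    rewrite mulr_ge0// ?subr_ge0 ?ltW ?powR2_gt1//.
    by rewrite addr_gt0// invr_gt0.
  pose q := (1 + alpha / beta * 2 `^ Rth)^-1.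
  apply: (@cvg_trans _ ((g * (1 - expR (- (m / g))) * q) @[g --> +oo]));
    last first.
    by apply: cvgMl; exact: cvg_mul_1BexpR.
  apply: near_eq_cvg; near=> g.
  have g0 : 0 < g by near: g; exact: nbhs_pinfty_gt.
  rewrite /f outage1E// /l /P1_lim -/m -/q; ring.
split=> //.
(* The zeroth-order limit follows from [fM]: write [f g] as [g^-1 * (g * (f g - l)) + l], where
   [g^-1] tends to 0. *)
rewrite [X in _ --> X](_ : l = 0 * M + l); last by rewrite mul0r add0r.
apply: (@cvg_trans _ ((g^-1 * (g * (f g - l)) + l) @[g --> +oo])).
  apply: near_eq_cvg; near=> g.
  have g0 : 0 < g by near: g; exact: nbhs_pinfty_gt.
  by rewrite mulKf ?gt_eqF// subrK.
by apply: cvgD; [apply: cvgM => //; exact: cvg_invr_pinfty|exact: cvg_cst].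
Unshelve. all: by end_near. Qed.
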